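(* Let $(K_n)_{n\ge1}$ be Markov kernels on a finite set $V$ and $\mu_0$ a probability measure; set $\mu_n=\mu_0K_{0,n}$, assumed positive for all $n$. Let $P_i=K_i^*K_i:\ell^2(\mu_i)\to\ell^2(\mu_i)$, with $K_i^*$ the adjoint of $K_i:\ell^2(\mu_i)\to\ell^2(\mu_{i-1})$, let $l(P_i)$ be its logarithmic Sobolev constant, and let $\sigma_1(K_i,\mu_{i-1})$ be the second largest singular value of $K_i:\ell^2(\mu_i)\to\ell^2(\mu_{i-1})$. For $x\in V$ set \[m_x=\min\Bigl\{t\in\mathbb N:\sum_{i=1}^t\log(1+l(P_i))\ge\log\log\bigl(\mu_0(x)^{-1/2}\bigr)\Bigr\}.\] Then for $n\ge m_x$, \[d_2(K_{0,n}(x,\cdot),\mu_n)^2\le e^2\prod_{i=m_x+1}^n\sigma_1(K_i,\mu_{i-1})^2.\]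
   Context: $K_{0,n}=K_1\cdots K_n$. $P_i(x,y)=\frac{1}{\mu_i(x)}\sum_z\mu_{i-1}(z)K_i(z,x)K_i(z,y)$; $\sigma_1(K_i,\mu_{i-1})$ is the square root of the second largest eigenvalue of $P_i$. $\mathcal E_{P,\nu}(f,f)=\frac12\sum_{x,y}|f(x)-f(y)|^2\nu(x)P(x,y)$; $\mathcal L(f^2,\nu)=\sum_xf^2\log(f^2/\|f\|^2_{\ell^2(\nu)})\nu(x)$; $l(P_i)=\inf\{\mathcal E_{P_i,\mu_i}(f,f)/\mathcal L(f^2,\mu_i):\mathcal L(f^2,\mu_i)\ne0,\ f\text{ nonconstant}\}$. $d_2(K_{0,n}(x,\cdot),\mu_n)=(\sum_y|K_{0,n}(x,y)/\mu_n(y)-1|^2\mu_n(y))^{1/2}$. *)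

(* Defs.v *)
From HB Require Import structures.
From mathcomp Require Import all_boot all_order all_algebra.
From mathcomp Require Import boolp classical_sets reals sequences exp.
Set Implicit Arguments. Unset Strict Implicit. Unset Printing Implicit Defensive.
Import Order.TTheory GRing.Theory Num.Theory.
Local Open Scope ring_scope.
Local Open Scope classical_set_scope.

Section Defs.
Variables (R : realType) (V : finType).

Definition kernel := V -> V -> R.

Fixpoint Kprod (K : nat -> kernel) (n : nat) : kernel :=
  match n with
  | 0 => fun x y => (x == y)%:R
  | n'.+1 => fun x y => \sum_(z : V) Kprod K n' x z * K n'.+1 z y
  end.

Definition mu (K : nat -> kernel) (mu0 : V -> R) (n : nat) (y : V) : R :=
  \sum_(x : V) mu0 x * Kprod K n x y.

Definition Pker (K : nat -> kernel) (mu0 : V -> R) (i : nat) : kernel :=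
  fun x y => (mu K mu0 i x)^-1 *
    \sum_(z : V) mu K mu0 i.-1 z * K i z x * K i z y.

Definition dirichlet (P : kernel) (nu : V -> R) (f : V -> R) : R :=
  2^-1 * \sum_(x : V) \sum_(y : V) (f x - f y) ^+ 2 * nu x * P x y.

Definition l2norm2 (nu : V -> R) (f : V -> R) : R :=
  \sum_(x : V) f x ^+ 2 * nu x.

(* L(f^2, nu) = sum_x f^2 log(f^2/||f||^2) nu(x)  (0 log 0 = 0 since ln 0 = 0) *)
Definition entropyL (nu : V -> R) (f : V -> R) : R :=
  \sum_(x : V) f x ^+ 2 * ln (f x ^+ 2 / l2norm2 nu f) * nu x.

Definition logsob (P : kernel) (nu : V -> R) : R :=
  inf [set dirichlet P nu f / entropyL nu f |
        f in [set f : V -> R | entropyL nu f != 0 /\ exists x y, f x != f y]].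

Definition kmx (P : kernel) : 'M[R]_#|V| :=
  \matrix_(i, j) P (enum_val i) (enum_val j).

Definition second_eig (n : nat) (A : 'M[R]_n) : R :=
  xget 0 [set b | exists s : seq R,
     [/\ sorted (fun a c => c <= a) s,
         char_poly A = \prod_(r <- s) ('X - r%:P) & b = s`_1]].

Definition sigma1 (K : nat -> kernel) (mu0 : V -> R) (i : nat) : R :=
  Num.sqrt (second_eig (kmx (Pker K mu0 i))).

Definition d2 (K : nat -> kernel) (mu0 : V -> R) (n : nat) (x : V) : R :=
  Num.sqrt (\sum_(y : V)
     (Kprod K n x y / mu K mu0 n y - 1) ^+ 2 * mu K mu0 n y).

Definition is_mx (K : nat -> kernel) (mu0 : V -> R) (x : V) (m : nat) : Prop :=
  let S t := \sum_(1 <= i < t.+1) ln (1 + logsob (Pker K mu0 i) (mu K mu0 i)) in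
  let c := ln (ln (mu0 x `^ (- 2^-1))) in
  c <= S m /\ forall t, (t < m)%N -> S t < c.

End Defs.

(* Main.v *)
Require Import Defs.
From HB Require Import structures.
From mathcomp Require Import all_boot all_order all_algebra.
From mathcomp Require Import complex ring lra.
From mathcomp Require Import boolp classical_sets reals sequences exp.
Set Implicit Arguments. Unset Strict Implicit. Unset Printing Implicit Defensive.
Import Order.TTheory GRing.Theory Num.Theory.
Local Open Scope ring_scope.

(** With [f = K_{0,n}(x,.)/mu_n - 1], which has [mu_n]-mean zero, the squared
    distance equals both [K_{0,n} f (x)] and [|f|^2], so it suffices to bound
    [(K_{0,n} f (x))^2] by [e^2 prod sigma_1^2 |f|^2].  The steps [i > m]
    contract mean-zero functions by [sigma_1(K_i)].  The first [m] steps are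
    hypercontractive: since [|Kg|_2^2 = |g|_2^2 - E_P(g,g)], the logarithmic
    Sobolev inequality and Jensen give
    [|K phi|_2^2 <= |phi|_2^2 - l Ent(phi^2) <= |phi|^2_{2/(1+l)}], hence
    [|Kg|_{q(1+l)} <= |g|_q] for [q >= 2].  Composing them yields
    [mu_0(x) |K_{0,m} g (x)|^{2 Pi} <= |g|_2^{2 Pi}] with
    [Pi = prod (1 + l_i) >= log (mu_0(x)^{-1/2})], so that
    [mu_0(x)^{-1/Pi} <= e^2]. *)

(** * Rayleigh quotients and the second eigenvalue of a real symmetric matrix *)

Section Spectral.
Local Open Scope sesquilinear_scope.

Lemma char_poly_similar (F : fieldType) n (A B P : 'M[F]_n) :
  P \in unitmx -> P *m A = B *m P -> char_poly A = char_poly B.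
Proof.
move=> Pu PA; rewrite /char_poly; set Q := map_mx polyC P.
have Qu : \det Q != 0.
  by rewrite det_map_mx polyC_eq0 -unitfE -unitmxE.
apply: (mulfI Qu); rewrite [RHS]mulrC -!det_mulmx.
congr (\det _); rewrite /char_poly_mx mulmxBr mulmxBl -!map_mxM PA.
by rewrite scalar_mxC.
Qed.

(** Over [R[i]] the matrix is Hermitian, hence unitarily diagonalizable with real eigenvalues; the
    factorization of the characteristic polynomial descends to [R] because the embedding is
    injective. *)
Lemma symmetric_diagonalization (R : rcfType) n (A : 'M[R]_n) : A^T = A ->
  exists (d : 'I_n -> R) (U : 'M[R[i]]_n),
  [/\ U \is unitarymx, char_poly A = \prod_(i < n) ('X - (d i)%:P) &
   map_mx (real_complex R) A =
     U^t* *m diag_mx (\row_i real_complex R (d i)) *m U].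
Proof.
move=> Asym; set e := real_complex R; set B := map_mx e A.
have Br : B \is a mxOver Num.real.
  by apply/mxOverP=> i j; rewrite mxE; apply/complex_realP; exists (A i j).
have Bh : B \is hermsymmx.
  apply: realsym_hermsym => //; apply/is_hermitianmxP.
  by rewrite expr0 scale1r map_mx_id // map_trmx Asym.
have /orthomx_spectralP Bs := hermitian_normalmx Bh.
have dr := hermitian_spectral_diag_real Bh.
set U := spectralmx B in Bs; set sp := spectral_diag B in Bs dr.
have Uu : U \is unitarymx := spectral_unitarymx B.
pose d i := complex.Re (sp 0 i).
have spE : sp = \row_i e (d i).
  apply/rowP=> i; rewrite mxE /d /e RRe_real //.
  exact: (mxOverP dr).
exists d, U; split=> //; last by rewrite -spE -invmx_unitary.
apply: (map_inj_poly (fmorph_inj (real_complex R))) => //.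
rewrite map_char_poly -/e -/B (@char_poly_similar _ _ B (diag_mx sp) U).
- rewrite char_poly_trig; last exact/diag_mx_is_trig.
  rewrite rmorph_prod; apply: eq_bigr => i _.
  by rewrite rmorphB /= map_polyX map_polyC spE !mxE eqxx mulr1n.
- exact: unitarymx_unit.
by rewrite {1}Bs !mulmxA mulmxV ?mul1mx // unitarymx_unit.
Qed.
Variable R : realType.
Local Notation C := (real_complex R).

Lemma le_second_eig n (A : 'M[R]_n) (d : 'I_n -> R) (i0 : 'I_n) :
  char_poly A = \prod_(i < n) ('X - (d i)%:P) -> (forall j, d j <= d i0) ->
  forall j, j != i0 -> d j <= second_eig A.
Proof.
move=> Ad dmax j ji; rewrite /second_eig.
(* The default value of [xget] is excluded: sorting the [d i] yields an admissible list. *)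
case: xgetP => [b _ [s [ss As ->]]|/(_ _)]; last first.
  set r := sort (fun a c : R => c <= a) [seq d i | i <- enum 'I_n].
  move=> /(_ r`_1) []; exists r; split=> //.
    by apply: sort_sorted => a c; exact: le_total.
  rewrite Ad (perm_big _ (permEl (perm_sort _ _))) /= big_map.
  by rewrite big_enum.
have ps : perm_eq s [seq d i | i <- enum 'I_n].
  by apply: prod_XsubC_eq; rewrite -As Ad big_map big_enum.
have pe : perm_eq (enum 'I_n) (i0 :: rem i0 (enum 'I_n)).
  by apply: perm_to_rem; rewrite mem_enum.
have {}ps := perm_trans ps (perm_map d pe).
case: s ss As ps => [|a s] ss As ps; first by have := perm_size ps.
have ge_tr : transitive (fun a c : R => c <= a) by move=> y x z h1 h2; exact: le_trans h1.
have a_ub c : c \in s -> c <= a by move: (order_path_min ge_tr ss) => /allP; apply.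
(* The head of [s] is the maximum [d i0]; cancelling it leaves a sorted permutation of the other
   [d j], whose own head bounds them all. *)
have ai : a = d i0.
  apply/eqP; rewrite eq_le; apply/andP; split.
    have : a \in d i0 :: [seq d i | i <- rem i0 (enum 'I_n)].
      by rewrite -(perm_mem ps) mem_head.
    by rewrite inE => /predU1P[->|/mapP[k _ ->]].
  have : d i0 \in a :: s by rewrite (perm_mem ps) mem_head.
  by rewrite inE => /predU1P[->|/a_ub].
rewrite {}ai /= perm_cons in ps.
have : d j \in s.
  rewrite (perm_mem ps) map_f // mem_rem_uniq ?enum_uniq //.
  by rewrite !inE ji mem_enum.
case: s {As ps a_ub} ss => [//|c s] /= /andP[_ ss].
have /allP bmax := order_path_min ge_tr ss.
by rewrite inE => /predU1P[->|/bmax].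
Qed.

(** The hypotheses make [a] the top eigenvalue. In an eigenbasis, every eigenvalue but one, met by
    [v], is at most [second_eig A]; orthogonality to [v] removes the remaining coordinate whenever
    its eigenvalue exceeds that bound. *)
Lemma rayleigh_le_second_eig n (A : 'M[R]_n) (v : 'rV[R]_n) (a : R) :
  A^T = A -> v != 0 -> v *m A = a *: v ->
  (forall y : 'rV[R]_n, (y *m A *m y^T) 0 0 <= a * (y *m y^T) 0 0) ->
  forall y : 'rV[R]_n, (y *m v^T) 0 0 = 0 ->
  (y *m A *m y^T) 0 0 <= second_eig A * (y *m y^T) 0 0.
Proof.
move=> Asym v0 vA Aa.
have [d [U [Uu Ad AU]]] := symmetric_diagonalization Asym.
have Ui : U *m U^t* = 1%:M by exact/unitarymxP.
have Ui' : U^t* *m U = 1%:M by exact: mulmx1C.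
(* Coordinates of [y] in the eigenbasis, complex since [U] is; [dotE] and [quadE] express the two
   forms in them. *)
pose co (y : 'rV[R]_n) : 'rV[R[i]]_n := map_mx C y *m U^t*.
have coT (y : 'rV[R]_n) : (co y)^t* = U *m map_mx C y^T.
  rewrite /co trmx_mul map_mxM trmxCK; congr (_ *m _).
  by apply/matrixP=> i j; rewrite !mxE -[LHS]/(conjc _) conjc_real.
have dotE (y z : 'rV[R]_n) : C ((y *m z^T) 0 0) = \sum_i co y 0 i * (co z 0 i)^*.
  have -> : C ((y *m z^T) 0 0) = (co y *m (co z)^t*) 0 0.
    rewrite coT /co mulmxA -(mulmxA _ _ U) Ui' mulmx1 -map_mxM.
    by rewrite [in RHS]mxE.
  by rewrite mxE; apply: eq_bigr => i _; rewrite !mxE.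
have quadE (y : 'rV[R]_n) :
    C ((y *m A *m y^T) 0 0) = \sum_i C (d i) * (co y 0 i * (co y 0 i)^*).
  have -> : C ((y *m A *m y^T) 0 0) =
      (co y *m diag_mx (\row_i C (d i)) *m (co y)^t*) 0 0.
    rewrite coT /co !mulmxA -(mulmxA _ _ (diag_mx _)) -(mulmxA _ _ U) -AU.
    by rewrite -!map_mxM [in RHS]mxE.
  rewrite mul_mx_diag mxE; apply: eq_bigr => i _; rewrite mulrA (mulrC (C _)).
  by rewrite !mxE.
(* A real root of the characteristic polynomial has a real eigenvector, on which [Aa] is tested. *)
have dle i : d i <= a.
  have : eigenvalue A (d i).
    rewrite eigenvalue_root_char Ad; apply/rootP.
    by rewrite (bigD1 i) //= hornerM hornerXsubC subrr mul0r.
  case/eigenvalueP=> y yA y0; have := Aa y; rewrite yA -scalemxAl mxE.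
  have pos k : true -> 0 <= y 0 k * y^T k 0 by rewrite mxE -expr2 sqr_ge0.
  rewrite ler_pM2r // mxE lt_neqAle sumr_ge0 ?andbT //.
  apply: contraNN y0 => /eqP/esym h; apply/eqP/rowP => k; rewrite [RHS]mxE.
  by have /eqP : y 0 k * y^T k 0 = 0 := psumr_eq0P pos h isT; rewrite mxE mulf_eq0 orbb => /eqP.
(* [v] is supported on the coordinates whose eigenvalue is [a]. *)
have wd i : co v 0 i != 0 -> d i = a.
  move=> wi; apply: (fmorph_inj (real_complex R)).
  apply: (mulIf wi).
  have : co v *m diag_mx (\row_i C (d i)) = C a *: co v.
    rewrite /co scalemxAl -map_mxZ -vA map_mxM AU !mulmxA.
    by rewrite -(mulmxA _ U) Ui mulmx1.
  move=> /rowP/(_ i); rewrite mul_mx_diag !mxE => <-.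
  by rewrite mulrC.
have [i0 w0] : exists i0, co v 0 i0 != 0.
  apply/existsP; apply: contraNT v0; rewrite negb_exists => /forallP w0.
  have {}w0 : co v = 0 by apply/rowP=> i; rewrite [RHS]mxE; apply/eqP; have := w0 i; rewrite negbK.
  have : map_mx C v = 0.
    by rewrite -[LHS]mulmx1 -Ui' mulmxA -/(co v) w0 mul0mx.
  by move=> /eqP; rewrite map_mx_eq0.
have b_ub : forall j, j != i0 -> d j <= second_eig A.
  by apply: (le_second_eig Ad) => j; rewrite (wd _ w0).
move=> y yv; rewrite -lecR -[leLHS]/(C _) quadE rmorphM /= dotE mulr_sumr.
apply: ler_sum => i _.
have [->|ii0] := eqVneq i i0; last first.
  by rewrite ler_wpM2r ?mul_conjC_ge0 // lecR b_ub.
(* Below, if [second_eig A < a] then [a] is simple, so [y] has no component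
   along its eigenvector [v]. *)
have [ab|ba] := leP a (second_eig A).
  by rewrite ler_wpM2r ?mul_conjC_ge0 // lecR (wd _ w0).
suff -> : co y 0 i0 = 0 by rewrite mul0r !mulr0.
have wj j : j != i0 -> co v 0 j = 0.
  move=> ji; apply/eqP/negP => /negP/wd dj.
  by have := b_ub _ ji; rewrite dj leNgt ba.
have := dotE y v; rewrite yv rmorph0 (bigD1 i0) //= big1 ?addr0; last first.
  by move=> j /wj ->; rewrite conjC0 mulr0.
by move/esym/eqP; rewrite mulf_eq0 conjC_eq0 (negPf w0) orbF => /eqP.
Qed.
End Spectral.

(** * Jensen-type and entropy inequalities on a finite weighted set *)

Section Inequalities.
Variable R : realType.

Lemma ln_leB1 (t : R) : 0 < t -> ln t <= t - 1.
Proof.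
move=> t0; have := @le_ln1Dx R (t - 1); rewrite addrCA subrr addr0; apply; lra.
Qed.

(** Young's inequality for [t * 1] with exponents [p] and [p / (p - 1)]; [p = 1] has no finite
    conjugate and is treated apart. *)
Lemma bernoulli_powR (t p : R) : 0 <= t -> 1 <= p -> 1 + p * (t - 1) <= t `^ p.
Proof.
move=> t0; rewrite le_eqVlt => /predU1P[<-|p1].
  by rewrite powRr1 //; lra.
have p0 : 0 < p by lra.
have q0 : 0 < p / (p - 1) by rewrite divr_gt0 //; lra.
have pq : p^-1 + (p / (p - 1))^-1 = 1 by field; lra.
have := conjugate_powR t0 (@ler01 R) p0 q0 pq.
rewrite mulr1 powR1 div1r -(ler_pM2r p0) mulrDl mulfVK ?gt_eqF //.
have -> : (p / (p - 1))^-1 * p = p - 1 by field; lra.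
lra.
Qed.

Section Weights.
Variable (V : finType).
Implicit Types (w u g : V -> R).

(** By Bernoulli, the [p]-th power lies above its tangent at the mean [b], and the tangent averages
    to the [p]-th power of [b]. *)
Lemma jensen_powR w g (p : R) : 1 <= p -> (forall y, 0 <= w y) ->
  \sum_y w y = 1 -> (forall y, 0 <= g y) ->
  (\sum_y w y * g y) `^ p <= \sum_y w y * g y `^ p.
Proof.
move=> p1 w0 w1 g0; set b := \sum_y w y * g y.
have b0 : 0 <= b by apply: sumr_ge0 => y _; exact: mulr_ge0.
have S0 : 0 <= \sum_y w y * g y `^ p.
  by apply: sumr_ge0 => y _; rewrite mulr_ge0 // powR_ge0.
move: b0; rewrite le_eqVlt => /predU1P[b0|b0].
  by rewrite -b0 powR0 // gt_eqF //; lra.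
have bp : 0 < b `^ p by exact: powR_gt0.
have -> : b `^ p = \sum_y w y * (b `^ p * (1 + p * (g y / b - 1))).
  transitivity (b `^ p * (\sum_y w y + p * ((\sum_y w y * g y) / b - \sum_y w y))).
    by rewrite -/b w1 divff ?gt_eqF // subrr mulr0 addr0 mulr1.
  rewrite mulr_suml -sumrB mulr_sumr -big_split mulr_sumr /=.
  by apply: eq_bigr => y _; ring.
apply: ler_sum => y _; apply: ler_wpM2l => //.
have gb : 0 <= g y / b by rewrite divr_ge0 // ltW.
apply: (@le_trans _ _ (b `^ p * (g y / b) `^ p)).
  by rewrite ler_pM2l // bernoulli_powR.
by rewrite -powRM ?(ltW b0) // mulrC divfK // gt_eqF.
Qed.

Lemma jensen_sqr w g : (forall y, 0 <= w y) -> \sum_y w y = 1 ->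
  (\sum_y w y * g y) ^+ 2 <= \sum_y w y * g y ^+ 2.
Proof.
move=> w0 w1; move bE: (\sum_y w y * g y) => b.
have : 0 <= \sum_y w y * (g y - b) ^+ 2.
  by apply: sumr_ge0 => y _; rewrite mulr_ge0 // sqr_ge0.
suff -> : \sum_y w y * (g y - b) ^+ 2 = \sum_y w y * g y ^+ 2 - b ^+ 2 by lra.
transitivity (\sum_y w y * g y ^+ 2 - 2 * b * (\sum_y w y * g y)
                + b ^+ 2 * \sum_y w y).
  rewrite !mulr_sumr -sumrB -big_split /=.
  by apply: eq_bigr => y _; ring.
by rewrite w1 bE; ring.
Qed.

Lemma entropyL_norm0 nu f : (forall y, 0 < nu y) -> @l2norm2 R V nu f = 0 ->
  entropyL nu f = 0.
Proof.
by move=> nu0 f0; apply: big1 => y _; rewrite f0 invr0 mulr0 ln0 // mulr0 mul0r.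
Qed.

Lemma l2norm2_ge0 nu f : (forall y, 0 < nu y) -> 0 <= @l2norm2 R V nu f.
Proof. by move=> nu0; apply: sumr_ge0 => y _; rewrite mulr_ge0 ?sqr_ge0 ?ltW. Qed.

(** Termwise, [ln_leB1] at [N / f^2] gives [f^2 ln (f^2 / N) >= f^2 - N], whose right side has
    [nu]-mean zero. *)
Lemma entropyL_ge0 nu f : (forall y, 0 < nu y) -> \sum_y nu y = 1 ->
  0 <= @entropyL R V nu f.
Proof.
move=> nu0 nu1; have := l2norm2_ge0 f nu0.
rewrite le_eqVlt => /predU1P[/esym/entropyL_norm0-> //|N0].
rewrite /entropyL; set N := l2norm2 nu f in N0 *.
have z0 : \sum_y (f y ^+ 2 - N) * nu y = 0.
  under eq_bigr do rewrite mulrBl.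
  by rewrite sumrB -mulr_sumr nu1 mulr1 subrr.
rewrite -[leLHS]z0; apply: ler_sum => y _; rewrite ler_pM2r //.
have := sqr_ge0 (f y); rewrite le_eqVlt => /predU1P[<-|u0].
  by rewrite mul0r; lra.
have := ln_leB1 (divr_gt0 N0 u0).
have -> : N / f y ^+ 2 = (f y ^+ 2 / N)^-1 by rewrite invf_div.
rewrite lnV ?posrE ?divr_gt0 // -(ler_pM2l u0) invf_div mulrBr mulrCA divff ?gt_eqF //.
by rewrite mulrN !mulr1; lra.
Qed.

(** With [N] the squared norm, [E] the entropy and [B] the sum on the right, Jensen for the
    logarithm gives [N (ln N - (1 + l) ln B) <= l E]; [ln_leB1] at [B^(1 + l) / N] then removes the
    logarithms. *)
Lemma norm_sub_entropy_le (nu f : V -> R) (l : R) : (forall y, 0 < nu y) -> 0 <= l ->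
  l2norm2 nu f - l * entropyL nu f <=
  (\sum_y (f y ^+ 2) `^ (1 + l)^-1 * nu y) `^ (1 + l).
Proof.
move=> nu0 l0; have := l2norm2_ge0 f nu0.
rewrite le_eqVlt => /predU1P[/esym N0|].
  by rewrite entropyL_norm0 // N0 mulr0 subr0 powR_ge0.
set N := l2norm2 nu f; set E := entropyL nu f; set th := (1 + l)^-1 => N0.
have l1 : 0 < 1 + l by lra.
have th0 : 0 < th by rewrite invr_gt0.
set B := \sum_y _.
have B0 : 0 < B.
  rewrite lt_neqAle sumr_ge0 ?andbT; last first.
    by move=> y _; rewrite mulr_ge0 ?powR_ge0 // ltW.
  apply/negP => /eqP/esym B0; suff : N = 0 by lra.
  rewrite /N /l2norm2; apply: big1 => y _.
  have pos z : true -> 0 <= (f z ^+ 2) `^ th * nu z.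
    by move=> _; rewrite mulr_ge0 ?powR_ge0 // ltW.
  have /eqP : (f y ^+ 2) `^ th * nu y = 0 := psumr_eq0P pos B0 isT.
  rewrite mulf_eq0 powR_eq0 (gt_eqF (nu0 y)) orbF (gt_eqF th0) andbT.
  by move=> /eqP->; rewrite mul0r.
(* Jensen for [ln] under the tilted measure [f^2 nu / N], multiplied by [N]. *)
have H : (th * ln N - ln B) * N + (th - 1) * E <= N / B * B - N.
  have NE : N = \sum_y f y ^+ 2 * nu y by [].
  have EE : E = \sum_y f y ^+ 2 * ln (f y ^+ 2 / N) * nu y by [].
  have BE : B = \sum_y (f y ^+ 2) `^ th * nu y by [].
  rewrite EE [X in _ * X + _]NE [X in _ <= N / B * X - _]BE.
  rewrite [X in _ <= _ - X]NE; clearbody N B.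
  rewrite !mulr_sumr -big_split -sumrB /=; apply: ler_sum => y _.
  have := sqr_ge0 (f y); set u := f y ^+ 2.
  rewrite le_eqVlt => /predU1P[<-|u0].
    by rewrite powR0 ?gt_eqF // !(mul0r, mulr0) subrr addr0.
  have up : 0 < u `^ th by exact: powR_gt0.
  have t0 : 0 < N / B * u `^ th / u by apply/divr_gt0/u0/mulr_gt0/up/divr_gt0.
  have un : 0 < u * nu y by exact: mulr_gt0.
  have := ler_wpM2l (ltW un) (ln_leB1 t0).
  have -> : ln (N / B * u `^ th / u) = ln N - ln B + th * ln u - ln u.
    have NB : 0 < N / B by exact: divr_gt0.
    have NBu : 0 < N / B * u `^ th by exact: mulr_gt0.
    rewrite ln_div ?posrE //.
    rewrite (@lnM _ (N / B) (u `^ th)) ?posrE //.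
    by rewrite (@ln_div _ N B) ?posrE // ln_powR.
  have lnNe : ln (f y ^+ 2 / N) = ln u - ln N by rewrite ln_div ?posrE.
  rewrite lnNe.
  have -> : u * nu y * (N / B * u `^ th / u - 1) =
            N / B * (u `^ th * nu y) - u * nu y.
    by field; rewrite !gt_eqF.
  lra.
rewrite divfK ?gt_eqF // subrr in H.
have {}H : (ln N - (1 + l) * ln B) * N <= l * E.
  move: (ler_wpM2l (ltW l1) H); rewrite mulr0.
  have -> : (1 + l) * ((th * ln N - ln B) * N + (th - 1) * E) =
            (ln N - (1 + l) * ln B) * N - l * E.
    by rewrite /th; field; rewrite gt_eqF.
  lra.
have B1 : 0 < B `^ (1 + l) by exact: powR_gt0.
have := ler_wpM2l (ltW N0) (ln_leB1 (divr_gt0 B1 N0)).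
rewrite ln_div ?posrE // ln_powR.
have -> : N * (B `^ (1 + l) / N - 1) = B `^ (1 + l) - N by field; rewrite gt_eqF.
lra.
Qed.
End Weights.
End Inequalities.

(** * One Markov step from [nu] to [mu]: contraction, logarithmic Sobolev inequality,
    hypercontractivity *)

Section Step.
Variables (R : realType) (V : finType).
Implicit Types (f g : V -> R).

Definition act (K : V -> V -> R) f x := \sum_y K x y * f y.

Variables (K : V -> V -> R) (nu mu : V -> R).
Hypotheses (K0 : forall x y, 0 <= K x y) (K1 : forall x, \sum_y K x y = 1).
Hypotheses (nu0 : forall x, 0 < nu x) (mu0 : forall x, 0 < mu x).
Hypotheses (mu1 : \sum_x mu x = 1) (muE : forall y, mu y = \sum_x nu x * K x y).

(** This is [mu x * P x y] for the reversible kernel [P = K^*K]: symmetric, with both marginals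
    [mu]. *)
Let edge x y := \sum_z nu z * K z x * K z y.
Let P x y := (mu x)^-1 * edge x y.

Let edgeC x y : edge x y = edge y x.
Proof. by apply: eq_bigr => z _; rewrite mulrAC. Qed.

Let edge_sum x : \sum_y edge x y = mu x.
Proof.
rewrite exchange_big muE; apply: eq_bigr => z _ /=.
by rewrite -mulr_sumr K1 mulr1.
Qed.

Lemma mean_act f : \sum_x nu x * act K f x = \sum_y mu y * f y.
Proof.
under eq_bigr do rewrite mulr_sumr.
rewrite exchange_big; apply: eq_bigr => y _ /=.
by rewrite muE mulr_suml; apply: eq_bigr => x _; rewrite mulrA.
Qed.

Lemma l2norm2_act_edge f :
  l2norm2 nu (act K f) = \sum_x \sum_y f x * edge x y * f y.
Proof.
transitivity (\sum_z \sum_x \sum_y nu z * K z x * K z y * (f x * f y)).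
  apply: eq_bigr => z _; rewrite expr2 {1}/act !mulr_suml.
  apply: eq_bigr => x _; rewrite mulr_sumr mulr_suml.
  by apply: eq_bigr => y _; ring.
rewrite exchange_big; apply: eq_bigr => x _; rewrite exchange_big.
apply: eq_bigr => y _ /=; rewrite mulrAC mulr_sumr.
by apply: eq_bigr => z _; ring.
Qed.

Lemma l2norm2_act_le f : l2norm2 nu (act K f) <= l2norm2 mu f.
Proof.
have -> : l2norm2 mu f = \sum_x nu x * act K (fun y => f y ^+ 2) x.
  by rewrite mean_act; apply: eq_bigr => y _; rewrite mulrC.
apply: ler_sum => x _; rewrite mulrC ler_pM2l //.
exact: jensen_sqr.
Qed.

(** On expanding the square, the pure terms give the norm since the marginals of [edge] are [mu];
    the mixed term is [l2norm2_act_edge]. *)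
Lemma dirichletE f : dirichlet P mu f = l2norm2 mu f - l2norm2 nu (act K f).
Proof.
have S1 : \sum_x \sum_y f x ^+ 2 * edge x y = l2norm2 mu f.
  by apply: eq_bigr => x _; rewrite -mulr_sumr edge_sum.
have S2 : \sum_x \sum_y f y ^+ 2 * edge x y = l2norm2 mu f.
  rewrite exchange_big -S1; apply: eq_bigr => x _; apply: eq_bigr => y _.
  by rewrite edgeC.
rewrite /dirichlet.
have -> : \sum_x \sum_y (f x - f y) ^+ 2 * mu x * P x y =
  l2norm2 mu f + l2norm2 mu f - 2 * l2norm2 nu (act K f).
  rewrite -{1}S1 -S2 l2norm2_act_edge mulr_sumr -big_split -sumrB /=.
  apply: eq_bigr => x _; rewrite mulr_sumr -big_split -sumrB /=.
  apply: eq_bigr => y _; rewrite /P -!mulrA (mulrA (mu x)) divff ?gt_eqF //.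
  by rewrite mul1r; ring.
lra.
Qed.

Lemma dirichlet_ge0 f : 0 <= dirichlet P mu f.
Proof. by rewrite dirichletE subr_ge0 l2norm2_act_le. Qed.

Lemma logsob_ge0 : 0 <= logsob P mu.
Proof.
rewrite /logsob; set S := (X in inf X).
(* If no [f] is admissible, as on a one-point [V], the infimum of the empty set is [0]. *)
have [->|/set0P S0] := eqVneq S set0; first by rewrite inf0.
apply: lb_le_inf => // _ [f _ <-].
by rewrite divr_ge0 ?dirichlet_ge0 ?entropyL_ge0.
Qed.

Lemma logsob_ineq f : logsob P mu * entropyL mu f <= dirichlet P mu f.
Proof.
have := entropyL_ge0 f mu0 mu1; rewrite le_eqVlt => /predU1P[<-|E0].
  by rewrite mulr0 dirichlet_ge0.
rewrite -ler_pdivlMr //; apply: ge_inf.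
  exists 0 => _ [g _ <-].
  by rewrite divr_ge0 ?dirichlet_ge0 ?entropyL_ge0.
exists f => //; split; first by rewrite gt_eqF.
(* Positive entropy makes [f] admissible in the infimum, since a constant would have entropy
   zero. *)
apply: contrapT => fc; suff : entropyL mu f = 0 by lra.
have fC x y : f x = f y by apply: contrapT => /eqP xy; apply: fc; exists x, y.
apply: big1 => y _.
have -> : l2norm2 mu f = f y ^+ 2.
  rewrite /l2norm2; under eq_bigr do rewrite (fC _ y).
  by rewrite -mulr_sumr mu1 mulr1.
have [->|fy] := eqVneq (f y) 0; first by rewrite expr0n /= !mul0r.
by rewrite divff ?expf_neq0 // ln1 mulr0 mul0r.
Qed.

(** Put [h = g^(q (1 + l) / 2)]. Since [q >= 2] this exponent is at least 1, so Jensen bounds the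
    left side by the squared norm of [K h]. The Sobolev inequality and [norm_sub_entropy_le] for [h]
    conclude, as [(h^2)^(1 / (1 + l)) = g^q]. *)
Lemma hypercontractive_step g (q : R) : (forall y, 0 <= g y) -> 2 <= q ->
  \sum_x nu x * act K g x `^ (q * (1 + logsob P mu)) <=
  (\sum_y mu y * g y `^ q) `^ (1 + logsob P mu).
Proof.
move=> g0 q2; set l := logsob P mu; have l0 : 0 <= l := logsob_ge0.
set h := fun y => g y `^ (2^-1 * (q * (1 + l))).
have hE y : h y ^+ 2 = g y `^ (q * (1 + l)).
  by rewrite -powR_mulrn ?powR_ge0 // -powRrM; congr (_ `^ _); lra.
apply: (@le_trans _ _ (l2norm2 nu (act K h))).
  apply: ler_sum => x _; rewrite mulrC ler_pM2r //.
  have -> : q * (1 + l) = 2^-1 * (q * (1 + l)) * 2%:R by lra.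
  have p1 : 1 <= 2^-1 * (q * (1 + l)) by nra.
  rewrite powRrM powR_mulrn ?powR_ge0 // lerXn2r ?nnegrE ?powR_ge0 //.
    by apply: sumr_ge0 => y _; rewrite mulr_ge0 ?powR_ge0.
  exact: jensen_powR.
have := norm_sub_entropy_le h mu0 l0.
have -> : \sum_y (h y ^+ 2) `^ (1 + l)^-1 * mu y = \sum_y mu y * g y `^ q.
  apply: eq_bigr => y _; rewrite hE -powRrM mulfK ?[mu y * _]mulrC //.
  by rewrite gt_eqF //; lra.
apply: le_trans.
by have := logsob_ineq h; rewrite dirichletE -/l; lra.
Qed.

(** Scaling by the square root of [mu] turns [P] into a symmetric matrix. The constant function
    becomes an eigenvector for the eigenvalue 1, which is maximal by contraction, and mean zero
    becomes orthogonality to it. *)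
Lemma l2norm2_act_second_eig f : \sum_y mu y * f y = 0 ->
  l2norm2 nu (act K f) <= second_eig (kmx P) * l2norm2 mu f.
Proof.
move=> fmean; pose e (i : 'I_#|V|) := enum_val i.
pose s i := Num.sqrt (mu (e i)).
have s0 i : 0 < s i by rewrite sqrtr_gt0.
have sn i : s i != 0 by rewrite gt_eqF.
have ss i : s i * s i = mu (e i) by rewrite -expr2 sqr_sqrtr // ltW.
have sumE (F : V -> R) : \sum_y F y = \sum_i F (e i).
  by rewrite (reindex e) //; exact/onW_bij/enum_val_bij.
(* [A = D P D^-1] with [D = diag s], so both have the same characteristic polynomial. *)
pose A := \matrix_(i < #|V|, j < #|V|) (edge (e i) (e j) / (s i * s j)).
have AE : second_eig (kmx P) = second_eig A.
  suff AP : char_poly (kmx P) = char_poly A by rewrite /second_eig AP.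
  apply: (@char_poly_similar _ _ _ _ (diag_mx (\row_i s i))).
    rewrite unitmxE det_diag unitfE; apply/prodf_neq0 => i _.
    by rewrite mxE.
  rewrite mul_diag_mx mul_mx_diag; apply/matrixP=> i j; rewrite !mxE.
  by rewrite /P -/(e i) -/(e j) -ss; field; rewrite !sn.
pose row f := \row_(j < #|V|) (f (e j) * s j).
have quadE g : (row g *m A *m (row g)^T) 0 0 = l2norm2 nu (act K g).
  rewrite l2norm2_act_edge sumE mxE.
  under eq_bigr do rewrite mxE mulr_suml.
  rewrite exchange_big; apply: eq_bigr => i _ /=; rewrite sumE.
  by apply: eq_bigr => j _; rewrite !mxE; field; rewrite !sn.
have normE g : (row g *m (row g)^T) 0 0 = l2norm2 mu g.
  rewrite mxE /l2norm2 sumE; apply: eq_bigr => i _; rewrite !mxE -ss; ring.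
rewrite AE -quadE -normE; apply: (@rayleigh_le_second_eig _ _ _ (row (fun=> 1)) 1).
- by apply/matrixP=> i j; rewrite !mxE edgeC (mulrC (s i)).
- apply/negP => /eqP row0; have := normE (fun=> 1).
  rewrite row0 mul0mx mxE /l2norm2 => /esym/eqP.
  by under eq_bigr do rewrite expr1n mul1r; rewrite mu1 oner_eq0.
- rewrite scale1r; apply/rowP=> j; rewrite !mxE mul1r.
  under eq_bigr => i _.
    rewrite !mxE.
    have -> : 1 * s i * (edge (e i) (e j) / (s i * s j)) = edge (e j) (e i) / s j.
      by rewrite edgeC; field; rewrite !sn.
    over.
  by rewrite -mulr_suml -(sumE (edge (e j))) edge_sum -ss mulfK.
(* Every vector is the [row] of a function, so the contraction bound covers all of them. *)
- move=> y; rewrite mul1r.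
  have -> : y = row (fun v => y 0 (enum_rank v) / s (enum_rank v)).
    by apply/rowP=> j; rewrite mxE enum_valK divfK.
  by rewrite quadE normE l2norm2_act_le.
rewrite mxE -[RHS]fmean sumE; apply: eq_bigr => i _.
by rewrite !mxE -ss; ring.
Qed.

End Step.

(** * Composition of the steps along the inhomogeneous chain *)

Section Chain.
Variables (R : realType) (V : finType) (K : nat -> V -> V -> R) (mu0 : V -> R).
Hypotheses (HKnn : forall i x y, (0 < i)%N -> 0 <= K i x y)
  (HKsum : forall i x, (0 < i)%N -> \sum_(y : V) K i x y = 1)
  (Hmu0nn : forall x, 0 <= mu0 x) (Hmu0sum : \sum_(x : V) mu0 x = 1)
  (Hpos : forall n y, 0 < mu K mu0 n y).
Implicit Types (f g : V -> R).

Let l i := logsob (Pker K mu0 i) (mu K mu0 i).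
(** Factor by which the Lebesgue exponent improves over the first [m] steps. *)
Let Pi m := \prod_(1 <= i < m.+1) (1 + l i).

Lemma mu_0 y : mu K mu0 0 y = mu0 y.
Proof.
rewrite /mu (bigD1 y) //= eqxx mulr1 big1 ?addr0 // => x /negPf->.
by rewrite mulr0.
Qed.

Lemma mu_S n y : mu K mu0 n.+1 y = \sum_x mu K mu0 n x * K n.+1 x y.
Proof.
rewrite /mu /=; under eq_bigr do rewrite mulr_sumr.
rewrite exchange_big; apply: eq_bigr => z _ /=; rewrite mulr_suml.
by apply: eq_bigr => x _; rewrite mulrA.
Qed.

Lemma mu_sum n : \sum_y mu K mu0 n y = 1.
Proof.
elim: n => [|n IHn]; first by under eq_bigr do rewrite mu_0.
under eq_bigr do rewrite mu_S.
rewrite exchange_big -[RHS]IHn; apply: eq_bigr => x _ /=.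
by rewrite -mulr_sumr HKsum // mulr1.
Qed.

Lemma Kprod_ge0 n x y : 0 <= Kprod K n x y.
Proof.
elim: n y => [|n IHn] y /=; first exact: ler0n.
by apply: sumr_ge0 => z _; rewrite mulr_ge0 ?HKnn.
Qed.

Lemma Kprod_sum n x : \sum_y Kprod K n x y = 1.
Proof.
elim: n => [|n IHn] /=.
  rewrite (bigD1 x) //= eqxx big1 ?addr0 // => y.
  by rewrite eq_sym => /negPf->.
rewrite exchange_big -[RHS]IHn; apply: eq_bigr => z _ /=.
by rewrite -mulr_sumr HKsum // mulr1.
Qed.

Lemma act_Kprod0 f x : act (Kprod K 0) f x = f x.
Proof.
rewrite /act (bigD1 x) //= eqxx mul1r big1 ?addr0 // => y.
by rewrite eq_sym => /negPf->; rewrite mul0r.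
Qed.

Lemma act_KprodS n f x :
  act (Kprod K n.+1) f x = act (Kprod K n) (act (K n.+1) f) x.
Proof.
rewrite /act /=; under eq_bigr do rewrite mulr_suml.
rewrite exchange_big; apply: eq_bigr => z _ /=; rewrite mulr_sumr.
by apply: eq_bigr => y _; rewrite mulrA.
Qed.

Lemma logsob_Pker_ge0 i : 0 <= l i.+1.
Proof.
apply: (@logsob_ge0 _ _ (K i.+1) (mu K mu0 i) (mu K mu0 i.+1)) => //.
- by move=> x y; apply: HKnn.
- by move=> x; apply: HKsum.
- exact: mu_sum.
exact: mu_S.
Qed.

Lemma logsob_prod_ge1 m : 1 <= Pi m.
Proof.
elim: m => [|m IHm]; first by rewrite /Pi big_nil.
by rewrite /Pi big_nat_recr //= -/(Pi m); have := logsob_Pker_ge0 m; nra.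
Qed.

(** Induction on [m]: the last kernel acts first on [g] and raises the exponent to [q (1 + l m.+1)],
    from which the other steps start; hence [q] is general. *)
Lemma hypercontractivity m g (q : R) : (forall y, 0 <= g y) -> 2 <= q ->
  \sum_x mu0 x * act (Kprod K m) g x `^ (q * Pi m) <=
  (\sum_y mu K mu0 m y * g y `^ q) `^ Pi m.
Proof.
elim: m g q => [|m IHm] g q g0 q2.
  rewrite /Pi big_nil mulr1 powRr1; last first.
    by apply: sumr_ge0 => y _; rewrite mulr_ge0 ?powR_ge0 // ltW.
  by apply: ler_sum => y _; rewrite act_Kprod0 mu_0.
have l0 := logsob_Pker_ge0 m; have P1 := logsob_prod_ge1 m.
have -> : Pi m.+1 = (1 + l m.+1) * Pi m by rewrite /Pi big_nat_recr //= mulrC.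
rewrite mulrA; under eq_bigr do rewrite act_KprodS.
apply: (le_trans (IHm _ _ _ _)).
- by move=> y; apply: sumr_ge0 => z _; rewrite mulr_ge0 ?HKnn.
- by nra.
rewrite powRrM ge0_ler_powR ?nnegrE ?powR_ge0 //; first by lra.
  by apply: sumr_ge0 => y _; rewrite mulr_ge0 ?powR_ge0 // ltW.
apply: hypercontractive_step => //.
- by move=> x y; apply: HKnn.
- by move=> x; apply: HKsum.
- exact: mu_sum.
exact: mu_S.
Qed.

Lemma act_Kprod_sqr_le m x g :
  ln (ln (mu0 x `^ (- 2^-1))) <= \sum_(1 <= i < m.+1) ln (1 + l i) ->
  act (Kprod K m) g x ^+ 2 <= expR 1 ^+ 2 * l2norm2 (mu K mu0 m) g.
Proof.
move=> Hm; have P1 := logsob_prod_ge1 m; have P0 : 0 < Pi m by lra.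
have m0 : 0 < mu0 x by rewrite -mu_0.
have {}Hm : - (2 * Pi m) <= ln (mu0 x).
  have SE : \sum_(1 <= i < m.+1) ln (1 + l i) = ln (Pi m).
    elim: m {Hm P1 P0} => [|m IHm]; first by rewrite /Pi !big_nil ln1.
    rewrite /Pi big_nat_recr // [in RHS]big_nat_recr //= IHm -/(Pi m) lnM ?posrE //.
      by have := logsob_prod_ge1 m; lra.
    by have := logsob_Pker_ge0 m; lra.
  rewrite SE ln_powR in Hm; set L := - 2^-1 * ln (mu0 x) in Hm.
  suff : L <= Pi m by rewrite /L; lra.
  (* For [L <= 0], that is [mu0 x = 1], [ln L] is only a default value, but then [L] is below [Pi m]
     by sign. *)
  have [L0|L0] := leP L 0; first by lra.
  by rewrite -ler_ln ?posrE.
(* Hypercontractivity is stated for nonnegative functions, whence the passage to [|g|]. *)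
set G := fun y => `|g y|; set t := act (Kprod K m) G x.
have t0 : 0 <= t by apply: sumr_ge0 => y _; rewrite mulr_ge0 ?Kprod_ge0 /G ?normr_ge0.
have gt : act (Kprod K m) g x ^+ 2 <= t ^+ 2.
  rewrite -real_normK ?num_real // lerXn2r ?nnegrE //.
  apply: le_trans (ler_norm_sum _ _ _) _; apply: ler_sum => y _.
  by rewrite normrM (ger0_norm (Kprod_ge0 _ _ _)).
apply: (le_trans gt).
set N := l2norm2 _ _; have N0 : 0 <= N by exact: l2norm2_ge0.
have H : mu0 x * (t ^+ 2) `^ Pi m <= N `^ Pi m.
  have -> : N = \sum_y mu K mu0 m y * G y `^ 2.
    apply: eq_bigr => y _; rewrite mulrC /G powR_mulrn ?normr_ge0 //.
    by rewrite real_normK ?num_real.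
  (* At [q = 2], only the atom [x] of the sum is kept. *)
  apply: le_trans (hypercontractivity m _ (lexx 2)); last by move=> y; apply: normr_ge0.
  rewrite (bigD1 x) //= -/t powRrM powR_mulrn // lerDl.
  by apply: sumr_ge0 => y _; rewrite mulr_ge0 ?powR_ge0.
have {}H : mu0 x `^ (Pi m)^-1 * t ^+ 2 <= N.
  have iP : 0 <= (Pi m)^-1 by rewrite invr_ge0 ltW.
  have := @ge0_ler_powR _ _ iP _ _ _ _ H.
  rewrite !nnegrE mulr_ge0 ?powR_ge0 // powRM ?powR_ge0 // => /(_ isT isT).
  by rewrite -!powRrM divff ?gt_eqF // !powRr1 ?sqr_ge0.
have e2 : (expR 1 ^+ 2)^-1 <= mu0 x `^ (Pi m)^-1.
  rewrite -expRM_natl mulr1 -expRN /powR gt_eqF // ler_expR mulrC ler_pdivlMr //.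
  by lra.
rewrite -ler_pdivrMl ?exprn_gt0 ?expR_gt0 //; apply: le_trans H.
by rewrite ler_wpM2r ?sqr_ge0.
Qed.

(** Induction on [n - m], peeling off the last kernel: it contributes its singular value and
    preserves mean zero by [mean_act]. *)
Lemma act_Kprod_mean0_sqr_le m n x f :
  ln (ln (mu0 x `^ (- 2^-1))) <= \sum_(1 <= i < m.+1) ln (1 + l i) ->
  (m <= n)%N -> \sum_y mu K mu0 n y * f y = 0 ->
  act (Kprod K n) f x ^+ 2 <=
  expR 1 ^+ 2 * \prod_(m.+1 <= i < n.+1) sigma1 K mu0 i ^+ 2 *
    l2norm2 (mu K mu0 n) f.
Proof.
move=> Hm /subnKC <-; elim: (n - m)%N f => [|k IHk] f fmean.
  by rewrite addn0 big_geq // mulr1 act_Kprod_sqr_le.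
rewrite addnS in fmean *; have muS := mu_S (m + k).
rewrite act_KprodS; apply: (le_trans (IHk _ _)).
  by rewrite (mean_act muS).
rewrite [in leRHS]big_nat_recr ?ltnS ?leq_addr //= mulrA -[leRHS]mulrA; apply: ler_wpM2l.
  by rewrite mulr_ge0 ?sqr_ge0 // prodr_ge0 // => i _; rewrite sqr_ge0.
apply: (@le_trans _ _ (second_eig (kmx (Pker K mu0 (m + k).+1)) *
                       l2norm2 (mu K mu0 (m + k).+1) f)).
  apply: l2norm2_act_second_eig => //.
  - by move=> y z; apply: HKnn.
  - by move=> y; apply: HKsum.
  exact: mu_sum.
apply: ler_wpM2r; first exact: l2norm2_ge0.
(* [Num.sqrt] vanishes on negative numbers, so [sigma1 ^+ 2] dominates [second_eig] whatever its
   sign. *)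
rewrite /sigma1; have [b0|b0] := leP 0 (second_eig (kmx (Pker K mu0 (m + k).+1))).
  by rewrite sqr_sqrtr.
by rewrite (le_trans (ltW b0)) ?sqr_ge0.
Qed.
End Chain.

Theorem theorem4p5 (R : realType) (V : finType)
  (K : nat -> V -> V -> R) (mu0 : V -> R)
  (HKnn : forall i x y, (0 < i)%N -> 0 <= K i x y)
  (HKsum : forall i x, (0 < i)%N -> \sum_(y : V) K i x y = 1)
  (Hmu0nn : forall x, 0 <= mu0 x)
  (Hmu0sum : \sum_(x : V) mu0 x = 1)
  (Hpos : forall n y, 0 < mu K mu0 n y)
  (x : V) (m : nat) (Hm : is_mx K mu0 x m) :
  forall n : nat, (m <= n)%N ->
    d2 K mu0 n x ^+ 2 <=
      expR 1 ^+ 2 * \prod_(m.+1 <= i < n.+1) sigma1 K mu0 i ^+ 2.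
Proof.
move=> n mn; case: Hm => Hm _.
pose f y := Kprod K n x y / mu K mu0 n y - 1.
have N0 : 0 <= l2norm2 (mu K mu0 n) f by exact: l2norm2_ge0.
rewrite /d2 sqr_sqrtr // -/(l2norm2 _ f).
have mufE y : mu K mu0 n y * f y = Kprod K n x y - mu K mu0 n y.
  by rewrite /f mulrBr mulr1 mulrCA divff ?mulr1 // gt_eqF.
have fmean : \sum_y mu K mu0 n y * f y = 0.
  under eq_bigr do rewrite mufE.
  by rewrite sumrB Kprod_sum // mu_sum // subrr.
(* Subtracting the zero mean of [f] replaces the weight [Kprod K n x y] by [mu K mu0 n y * f y]. *)
have actE : act (Kprod K n) f x = l2norm2 (mu K mu0 n) f.
  rewrite -[LHS]subr0 -[X in _ - X]fmean /act -sumrB; apply: eq_bigr => y _.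
  by rewrite -mulrBl -mufE; ring.
have := act_Kprod_mean0_sqr_le HKnn HKsum Hmu0nn Hmu0sum Hpos Hm mn fmean.
(* The bound now reads [N^2 <= C N] with [N] the squared norm of [f]; a positive [N] is
   cancelled. *)
rewrite actE; move: N0; rewrite le_eqVlt => /predU1P[<- _|N0].
  by rewrite mulr_ge0 ?sqr_ge0 // prodr_ge0 // => i _; rewrite sqr_ge0.
by rewrite expr2 ler_pM2r.
Qed.
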